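(* There is a polynomial-time algorithm which, given any instance of weighted token swapping whose underlying graph $G$ is a tree, outputs a valid sequence of swaps transforming the starting assignment into the destination assignment whose total cost is at most $\left(1+\frac{W}{w}\right)\cdot \mathrm{OPT}$, where $w=\min_{t\in T}\omega(t)$, $W=\max_{t\in T}\omega(t)$, and $\mathrm{OPT}$ is the minimum cost of such a sequence.
   Context: An instance of weighted token swapping consists of a connected simple undirected graph $G=(V,E)$ with $n=|V|$ vertices, a set $T$ of $n$ tokens, a weight function $\omega:T\to\mathbb{R}_{>0}$, and two bijections $v_0,v_f:T\to V$ (starting and destination vertices). At all times each vertex holds exactly one token; initially token $t$ is on $v_0(t)$. A swap along an edge $(u,u')\in E$ exchanges the tokens on $u$ and $u'$, and costs the sum of the weights of the two swapped tokens. A valid solution is a sequence of swaps after which every token $t$ is on $v_f(t)$; its cost is the sum of the costs of its swaps. $\mathrm{OPT}$ denotes the minimum cost of a valid solution. *)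

(* Defs.v *)
From HB Require Import structures.
From mathcomp Require Import all_boot all_order all_fingroup all_algebra.
From mathcomp Require Import boolp classical_sets reals.
Set Implicit Arguments.
Unset Strict Implicit.
Unset Printing Implicit Defensive.
Import Order.TTheory GRing.Theory Num.Theory.

Local Open Scope classical_set_scope.
Local Open Scope ring_scope.

Definition is_minimum (R : realType) (A : set R) (x : R) : Prop :=
  A x /\ lbound A x.

Definition is_maximum (R : realType) (A : set R) (x : R) : Prop :=
  A x /\ ubound A x.

(** * Weighted token swapping *)

(* That there are as many tokens as vertices follows from [start_bij]. *)
Record wts_instance (R : realType) := WtsInstance {
  vertex : finType;
  token : finType;
  adj : rel vertex;
  adj_sym : symmetric adj;
  adj_irr : irreflexive adj;
  adj_connected : forall u v : vertex, connect adj u v;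
  weight : token -> R;
  weight_gt0 : forall t, 0 < weight t;
  start : token -> vertex;
  dest : token -> vertex;
  start_bij : bijective start;
  dest_bij : bijective dest
}.

(* [ucycle e c] also accepts the empty sequence, single vertices with a loop
   and, for symmetric [e], an edge traversed back and forth; a cycle of a
   simple graph has at least three vertices. *)
Definition acyclic (V : finType) (e : rel V) : Prop :=
  forall c : seq V, ucycle e c -> (size c < 3)%N.

Definition is_tree (V : finType) (e : rel V) : Prop :=
  (forall u v : V, connect e u v) /\ acyclic e.

Section Solutions.
Variables (R : realType) (I : wts_instance R).
Local Notation V := (vertex I).
Local Notation T := (token I).

(* A placement maps each token to the vertex holding it. *)
Definition swap_tokens (f : T -> V) (e : V * V) : T -> V :=
  fun t => tperm e.1 e.2 (f t).

Definition placement_after (s : seq (V * V)) : T -> V :=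
  foldl swap_tokens (@start R I) s.

Definition swap_cost (f : T -> V) (e : V * V) : R :=
  \sum_(t | (f t == e.1) || (f t == e.2)) weight t.

Fixpoint cost_from (f : T -> V) (s : seq (V * V)) : R :=
  if s is e :: s' then swap_cost f e + cost_from (swap_tokens f e) s' else 0.

Definition cost (s : seq (V * V)) : R := cost_from (@start R I) s.

Definition valid_solution (s : seq (V * V)) : Prop :=
  all (fun e => adj e.1 e.2) s /\ forall t, placement_after s t = dest t.

Definition is_OPT (x : R) : Prop :=
  is_minimum [set cost s | s in [set s | valid_solution s]] x.

End Solutions.

(** * Model of computation *)

(* Structured programs over finitely many (program-dependent) arrays of natural
   numbers and of reals, with unit cost per executed assignment or test.

   The only arithmetic is addition and subtraction.  Hence in [t] steps the
   bit length of natural numbers grows by O(t) only, and likewise for the weight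
   registers when the weights are rationals in binary: up to a polynomial the
   step count is Turing machine time on such inputs.  For arbitrary real
   weights the model is a real RAM without multiplication or rounding.  The
   reals have no constants, so programs do not depend on [R]. *)
Inductive nexp :=
| NConst of nat
| NGet of nat & nexp            (* array name, index *)
| NAdd of nexp & nexp
| NSub of nexp & nexp.          (* truncated *)

Inductive rexp :=
| RGet of nat & nexp
| RAdd of rexp & rexp
| RSub of rexp & rexp.

Inductive bexp :=
| BNLe of nexp & nexp
| BRLe of rexp & rexp
| BNot of bexp
| BAnd of bexp & bexp.

Inductive program :=
| Skip
| NSet of nat & nexp & nexp     (* array name, index, value *)
| RSet of nat & nexp & rexp
| Seq of program & program
| If of bexp & program & program
| While of bexp & program.

Record store (R : realType) := Store {
  nmem : nat -> nat -> nat;     (* array name, index *)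
  rmem : nat -> nat -> R
}.

Definition update (A : Type) (m : nat -> nat -> A) (a i : nat) (x : A) :
    nat -> nat -> A :=
  fun b j => if (b == a) && (j == i) then x else m b j.

Section Semantics.
Variable R : realType.
Implicit Type s : store R.

Fixpoint neval s (e : nexp) : nat :=
  match e with
  | NConst k => k
  | NGet a i => nmem s a (neval s i)
  | NAdd e1 e2 => (neval s e1 + neval s e2)%N
  | NSub e1 e2 => (neval s e1 - neval s e2)%N
  end.

Fixpoint reval s (e : rexp) : R :=
  match e with
  | RGet a i => rmem s a (neval s i)
  | RAdd e1 e2 => reval s e1 + reval s e2
  | RSub e1 e2 => reval s e1 - reval s e2
  end.

Fixpoint beval s (b : bexp) : bool :=
  match b with
  | BNLe e1 e2 => (neval s e1 <= neval s e2)%N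
  | BRLe e1 e2 => reval s e1 <= reval s e2
  | BNot b1 => ~~ beval s b1
  | BAnd b1 b2 => beval s b1 && beval s b2
  end.

(* [exec c s k s']: started in [s], [c] halts in [s'] after [k] steps. *)
Inductive exec : program -> store R -> nat -> store R -> Prop :=
| ExecSkip s : exec Skip s 0 s
| ExecNSet a i e s :
    exec (NSet a i e) s 1
      (Store (update (nmem s) a (neval s i) (neval s e)) (rmem s))
| ExecRSet a i e s :
    exec (RSet a i e) s 1
      (Store (nmem s) (update (rmem s) a (neval s i) (reval s e)))
| ExecSeq c1 c2 s1 s2 s3 k1 k2 :
    exec c1 s1 k1 s2 -> exec c2 s2 k2 s3 ->
    exec (Seq c1 c2) s1 (k1 + k2) s3
| ExecIf b c1 c2 s k s' :
    exec (if beval s b then c1 else c2) s k s' ->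
    exec (If b c1 c2) s k.+1 s'
| ExecWhileFalse b c s :
    ~~ beval s b -> exec (While b c) s 1 s
| ExecWhileTrue b c s1 s2 s3 k1 k2 :
    beval s1 b -> exec c s1 k1 s2 -> exec (While b c) s2 k2 s3 ->
    exec (While b c) s1 (k1 + k2).+1 s3.

Lemma exec_deterministic c s k1 s1 k2 s2 :
  exec c s k1 s1 -> exec c s k2 s2 -> k1 = k2 /\ s1 = s2.
Proof.
move=> e1; elim: e1 k2 s2 => {c s k1 s1}
  [s|a i e s|a i e s|c1 c2 s1 s2 s3 k1 k2 _ IH1 _ IH2|b c1 c2 s k s' _ IH
  |b c s nb|b c s1 s2 s3 k1 k2 b1 _ IH1 _ IH2] k' t' e2.
- by inversion e2.
- by inversion e2.
- by inversion e2.
- inversion e2 as [| | |? ? ? t ? ? ? f1 f2| | |]; subst.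
  by case: (IH1 _ _ f1) => <- et; subst; case: (IH2 _ _ f2) => <- ->.
- inversion e2 as [| | | |? ? ? ? ? ? f1| |]; subst.
  by case: (IH _ _ f1) => <- ->.
- by inversion e2 as [| | | | | |? ? ? ? ? ? ? b1]; subst=> //; rewrite b1 in nb.
- inversion e2 as [| | | | |? ? ? nb|? ? ? t ? ? ? _ f1 f2]; subst.
    by rewrite b1 in nb.
  by case: (IH1 _ _ f1) => <- et; subst; case: (IH2 _ _ f2) => <- ->.
Qed.

End Semantics.

(** * Encoding of instances and of swap sequences *)

Definition number (X : finType) (x : X) : nat := index x (enum X).

Section Encoding.
Variables (R : realType) (I : wts_instance R).
Local Notation V := (vertex I).
Local Notation T := (token I).

(* Array 0 holds the number of vertices, array 1 the adjacency matrix in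
   row-major order, arrays 2 and 3 the starting and destination vertices of
   the tokens.  All other cells are 0. *)
Definition input_array (a : nat) : seq nat :=
  match a with
  | 0%N => [:: #|V|]
  | 1%N => [seq nat_of_bool (adj u v) | u <- enum V, v <- enum V]
  | 2%N => [seq number (start t) | t <- enum T]
  | 3%N => [seq number (dest t) | t <- enum T]
  | _ => [::]
  end.

Definition input_weights (a : nat) : seq R :=
  if a is 0%N then [seq weight t | t <- enum T] else [::].

Definition input_store : store R :=
  Store (fun a i => nth 0%N (input_array a) i)
        (fun a i => nth 0 (input_weights a) i).

Definition encode_swaps (s : seq (V * V)) : seq (nat * nat) :=
  [seq (number e.1, number e.2) | e <- s].

End Encoding.

(* Cell 0 of array 4 holds the number of swaps, arrays 5 and 6 their
   endpoints. *)
Definition output (R : realType) (s : store R) : seq (nat * nat) :=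
  [seq (nmem s 5 i, nmem s 6 i) | i <- iota 0 (nmem s 4 0)].

(* Main.v *)
Require Import Defs.
From mathcomp Require Import all_boot all_order all_fingroup all_algebra.
From mathcomp Require Import boolp reals.
From mathcomp Require Import zify ring lra.
Import Order.TTheory GRing.Theory Num.Theory.
Set Implicit Arguments.
Unset Strict Implicit.
Unset Printing Implicit Defensive.
Local Open Scope ring_scope.

(* Let [s] map a vertex to the destination of the token on it, and give the
   vertex [x] the weight [lam x] of the token with destination [x].  The
   algorithm swaps along any edge on which one token gets closer to its
   destination, while the other one either gets closer too or already is at its
   destination.  Acyclicity provides such an edge as long as [s != 1]: otherwise
   following next hops from a misplaced token leads to a cycle.

   Each swap is paid for by the potential
     sum_x d(x, s x) * (lam (s x) + W)
       + 2 * sum over the cycles of s of their minimal weight,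
   so the total cost is at most sum_t d(t) * (weight t + W), whereas every
   solution costs at least sum_t d(t) * weight t.  With unit weights the same
   potential bounds the number of swaps by the square of the number of
   vertices. *)

(** * Distances and improving swaps *)

Section Distance.
Local Open Scope nat_scope.
Variables (V : finType) (e : rel V).

(** The least length of a walk from [u] to [z]; [find] returns [#|V|] when no walk shorter than
    [#|V|] exists. *)
Definition gdist (u z : V) : nat :=
  find (fun k => [exists p : k.-tuple V, path e u p && (last u p == z)])
       (iota 0 #|V|).

Lemma gdist_le u p : path e u p -> gdist u (last u p) <= size p.
Proof.
move=> up; rewrite leqNgt; apply/negP => lt.
have szn : size p < #|V|.
  by apply: leq_trans lt _; rewrite -[X in _ <= X](size_iota 0); exact: find_size.
have /negbT/negP := before_find 0 lt; apply; rewrite nth_iota // add0n /=.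
apply/existsP; exists (in_tuple p); by rewrite up eqxx.
Qed.

Lemma gdistxx u : gdist u u = 0.
Proof. by apply/eqP; rewrite -leqn0; exact: (@gdist_le u [::]). Qed.

Hypothesis conn : forall u v, connect e u v.

Lemma gdist_lt_card u z : gdist u z < #|V|.
Proof.
have /connectP[p0 /shortenP[p up uniq_p _] ->] := conn u z.
apply: leq_ltn_trans (gdist_le up) _.
by have := max_card (mem (u :: p)); rewrite (card_uniqP uniq_p).
Qed.

Lemma gdist_path u z :
  exists p, [/\ path e u p, last u p = z & size p = gdist u z].
Proof.
have hs : has (fun k => [exists p : k.-tuple V, path e u p && (last u p == z)])
       (iota 0 #|V|).
  by rewrite has_find size_iota; exact: gdist_lt_card.
have := nth_find 0 hs; rewrite nth_iota ?add0n /=; last exact: gdist_lt_card.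
by case/existsP=> p /andP[up /eqP lp]; exists p; rewrite size_tuple.
Qed.

Lemma gdist_eq0 u z : gdist u z = 0 -> u = z.
Proof. by have [p [_ <- <-]] := gdist_path u z; move/size0nil->. Qed.

Lemma gdist_adj u v z : e u v -> gdist u z <= (gdist v z).+1.
Proof.
move=> uv; have [p [vp <- <-]] := gdist_path v z.
by apply: (@gdist_le u (v :: p)); rewrite /= uv.
Qed.

Lemma gdist_next u z : u != z -> exists2 v, e u v & gdist u z = (gdist v z).+1.
Proof.
move=> uz; have [[|v p] [up lp szp]] := gdist_path u z.
  by move: uz; rewrite -lp eqxx.
move: up lp szp => /= /andP[uv vp] lp szp; exists v => //.
by apply/eqP; rewrite eqn_leq gdist_adj // -szp -lp ltnS gdist_le.
Qed.

Hypothesis acyc : acyclic e.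

(** If no such edge exists, the next hop [g u] from a misplaced token again holds a misplaced token,
    and [g (g u) != u]. Iterating [g] then runs into a cycle of at least three vertices. *)
Lemma greedy_progress (s : {perm V}) : s != 1%g ->
  exists u v, [/\ e u v, gdist v (s u) < gdist u (s u)
                & (s v == v) || (gdist u (s v) < gdist v (s v))].
Proof.
move=> s1; pose A := [set x | s x != x].
have A0 : A != set0.
  apply: contra s1 => /eqP A0; apply/eqP/permP => x; rewrite perm1.
  by have := in_set0 x; rewrite -A0 inE => /negbFE/eqP.
have /fin_all_exists[g gP] (u : V) : exists v, s u != u ->
    e u v /\ gdist u (s u) = (gdist v (s u)).+1.
  have [|su] := eqVneq (s u) u; first by exists u.
  by have [|v uv dv] := @gdist_next u (s u); [rewrite eq_sym | exists v].
apply: contrapT => none.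
have gA u : s u != u -> s (g u) != g u /\ g (g u) != u.
  move=> su; have [ugu dgu] := gP u su.
  have sgu : s (g u) != g u.
    by apply/negP => h; apply: none; exists u, (g u); rewrite h dgu; split.
  split=> //; apply/eqP => ggu; apply: none; exists u, (g u).
  have [_ dggu] := gP _ sgu.
  by rewrite ggu in dggu; rewrite dgu dggu !ltnS !leqnn orbT; split.
pose closed (B : {set V}) := [&& B != set0, B \subset A & g @: B \subset B].
have clA : closed A.
  rewrite /closed A0 subxx /=; apply/subsetP => y /imsetP[x].
  by rewrite !inE => xA ->; have [] := gA x xA.
(* Minimality forces [g @: B = B], and on a finite set this makes [g] injective, so the orbit of a
   point of [B] closes up. *)
have [B /minsetP[/and3P[B0 BA gB] minB] _] := minset_exists clA.
have gBB : g @: B = B.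
  apply: minB => //; apply/and3P; split; last by rewrite imsetS.
    by rewrite imset_eq0.
  exact: subset_trans BA.
have ginj : {in B &, injective g} by apply/imset_injP; rewrite gBB.
have gclosed : {in B, forall x, g x \in B} by move=> x xB; rewrite -gBB imset_f.
have [x xB] := set0Pn _ B0.
have cyc := cycle_orbit_in gclosed ginj xB.
have orbB : all (mem B) (fingraph.orbit g x).
  apply/allP => y; rewrite -fconnect_orbit => /iter_findex <-.
  by elim: (findex _ _ _) => //= k; exact: gclosed.
have /acyc : ucycle e (fingraph.orbit g x).
  apply/andP; split; last exact: orbit_uniq.
  apply: (sub_in_cycle _ orbB cyc) => y z yB _ /eqP<-.
  by have /(subsetP BA) := yB; rewrite inE => /gP[].
(* Acyclicity leaves only orbits of one or two points, and both give [g (g x) = x]. *)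
rewrite size_orbit.
have := fingraph.iter_order_in gclosed ginj xB.
have := subsetP BA _ xB; rewrite inE => sx.
have [sgx ggx] := gA x sx.
case: (fingraph.order g x) (fingraph.order_gt0 g x) => [|[|[|]]] //= _.
  by move=> gx; move: ggx; rewrite !gx eqxx.
by move=> gx; move: ggx; rewrite gx eqxx.
Qed.

End Distance.

(** * Cycles of a permutation multiplied by a transposition *)

Section Orbits.
Local Open Scope group_scope.
Variables (V : finType).
Implicit Types (s : {perm V}) (x y z : V).

Lemma porbit_sub s (A : {set V}) x :
  {in A, forall z, s z \in A} -> x \in A -> porbit s x \subset A.
Proof.
move=> sA xA; apply/subsetP => _ /porbitP[i ->].
by elim: i => [|i IH]; rewrite ?expg0 ?perm1 // expgSr permM sA.
Qed.

Lemma tperm_stable s (A : {set V}) x y :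
  {in A, forall z, s z \in A} -> x \in A -> y \in A ->
  {in A, forall z, (tperm x y * s) z \in A}.
Proof. by move=> sA xA yA z zA; rewrite permM; case: tpermP => *; exact: sA. Qed.

Lemma porbit_stable s x : {in porbit s x, forall z, s z \in porbit s x}.
Proof.
by move=> _ /porbitP[i ->]; rewrite -permM -expgSr mem_porbit.
Qed.

(** Multiplying by the transposition twice restores the number of cycles, and each time it changes
    by one: what is a merge in one direction is a split in the other. *)
Lemma mem_porbit_tperm s x y : x != y ->
  (x \in porbit (tperm x y * s) y) = (x \notin porbit s y).
Proof.
move=> xy; have := porbits_mul_tperm s x y.
have := porbits_mul_tperm (tperm x y * s) x y.
rewrite /= mulgA tperm2 mul1g xy /=.
by do 2!case: (_ \in _) => //=; lia.
Qed.

(** The transposition does nothing outside the two cycles. Inside, the new cycle of [x] contains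
    [y], hence is stable under [s = tperm x y * s'] and swallows both old cycles. *)
Lemma porbits_tperm s x y : x \notin porbit s y ->
  porbits (tperm x y * s) =
  (porbit s x :|: porbit s y) |: (porbits s :\ porbit s x :\ porbit s y).
Proof.
move=> xNy; have xy : x != y.
  by apply: contraNneq xNy => ->; exact: porbit_id.
set U := porbit s x :|: porbit s y; set s' := tperm x y * s.
have xU : x \in U by rewrite inE porbit_id.
have yU : y \in U by rewrite inE porbit_id orbT.
have sU : {in U, forall z, s z \in U}.
  by move=> z; rewrite !inE => /orP[] /porbit_stable ->; rewrite ?orbT.
have xy' : porbit s' x = porbit s' y.
  by apply/eqP; rewrite eq_porbit_mem mem_porbit_tperm.
have inU z : z \in U -> porbit s' z = U.
  move=> zU; have Us' : U \subset porbit s' x.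
    have st : {in porbit s' x, forall z, s z \in porbit s' x}.
      move=> w wP; have -> : s = tperm x y * s' by rewrite mulgA tperm2 mul1g.
      apply: tperm_stable => //; first exact: porbit_stable.
        exact: porbit_id.
      by rewrite xy' porbit_id.
    rewrite subUset; apply/andP; split; apply: porbit_sub => //.
      exact: porbit_id.
    by rewrite xy' porbit_id.
  have := subsetP Us' _ zU; rewrite -eq_porbit_mem => /eqP->.
  apply/eqP; rewrite eqEsubset Us' andbT; apply: porbit_sub => //.
  exact: tperm_stable.
have outU z : z \notin U -> porbit s' z = porbit s z.
  move=> zU; have st i : (s' ^+ i) z = (s ^+ i) z.
    elim: i => [|i IH]; first by rewrite !expg0.
    rewrite !expgSr !permM IH tpermD //; apply: contraNneq zU => eqz.
      by have := mem_porbit s i z; rewrite -eqz porbit_sym inE => ->.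
    by have := mem_porbit s i z; rewrite -eqz porbit_sym inE orbC => ->.
  by apply/setP => w; apply/porbitP/porbitP => -[i ->]; exists i; rewrite st.
apply/setP => B; rewrite !inE; apply/imsetP/orP.
- case=> z _ ->; have [zU|zU] := boolP (z \in U).
    by left; rewrite inU.
  right; rewrite outU // !eq_porbit_mem imset_f // andbT.
  by move: zU; rewrite inE negb_or => /andP[-> ->].
- case=> [/eqP->|/and3P[By Bx /imsetP[z _ Bz]]].
    by exists x; rewrite // inU.
  exists z => //; rewrite outU // inE negb_or -!eq_porbit_mem -Bz.
  by rewrite Bx By.
Qed.

(** This identity serves merges directly, and splits when instantiated with [tperm x y * s]. *)
Lemma sum_porbits_tperm (R : zmodType) (m : {set V} -> R) s x y :
  x \notin porbit s y ->
  (\sum_(B in porbits (tperm x y * s)) m B + (m (porbit s x) + m (porbit s y))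
   = \sum_(B in porbits s) m B + m (porbit s x :|: porbit s y))%R.
Proof.
move=> xNy; have yNx : porbit s y != porbit s x.
  by rewrite eq_sym eq_porbit_mem.
(* The union is not among the remaining cycles: such a cycle of [s] would be that of both [x] and
   [y]. *)
rewrite porbits_tperm // big_setU1 /=; last first.
  rewrite !inE; apply/negP => /and3P[_ _ /imsetP[z _ eqz]].
  have /eqP: porbit s x = porbit s z.
    by apply/eqP; rewrite eq_porbit_mem -eqz inE porbit_id.
  have /eqP <- : porbit s y == porbit s z.
    by rewrite eq_porbit_mem -eqz inE porbit_id orbT.
  by rewrite eq_sym (negPf yNx).
rewrite [in RHS](big_setD1 (porbit s x)) /=; last by rewrite imset_f.
rewrite [in RHS](big_setD1 (porbit s y)) /=; last by rewrite !inE yNx imset_f.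
by rewrite [RHS]addrC -!addrA; congr (_ + _)%R; rewrite addrC addrA.
Qed.

End Orbits.

(** * The potential *)

Section Potential.
Variables (R : realType) (V : finType) (e : rel V) (lam : V -> R) (W : R).
Hypothesis conn : forall u v, connect e u v.
Hypothesis lam_ge0 : forall x, 0 <= lam x.
Hypothesis lam_leW : forall x, lam x <= W.
Implicit Types (s : {perm V}) (u v x : V) (A B : {set V}).

Definition min_weight A : R := \big[Order.min/W]_(x in A) lam x.

Definition cycle_weight s : R := \sum_(B in porbits s) min_weight B.

Definition travel_weight s : R :=
  \sum_x (gdist e x (s x))%:R * (lam (s x) + W).

Definition potential s : R := travel_weight s + 2 * cycle_weight s.

Lemma min_weight_le A x : x \in A -> min_weight A <= lam x.
Proof. exact: bigmin_le_cond. Qed.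

Lemma min_weight_leW A : min_weight A <= W.
Proof. exact: bigmin_le_id. Qed.

Lemma min_weight_set1 x : min_weight [set x] = lam x.
Proof. by rewrite /min_weight bigmin_set1 min_l. Qed.

Lemma min_weightU A B :
  min_weight (A :|: B) = Num.min (min_weight A) (min_weight B).
Proof. exact: bigminU. Qed.

Lemma min_weight_ge0 A : 0 <= W -> 0 <= min_weight A.
Proof.
by move=> W0; apply/bigmin_geP; split.
Qed.

(** The swap merges the cycle [[set v]] into that of [u]; the merged minimum is at most the one of
    the cycle of [u], so the contribution [lam v] is lost. *)
Lemma cycle_weight_fixed s u v : u != v -> s v = v ->
  cycle_weight (tperm u v * s)%g + lam v <= cycle_weight s.
Proof.
move=> uv sv.
have pv : porbit s v = [set v].
  apply/eqP; rewrite eqEsubset sub1set porbit_id andbT.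
  by apply: porbit_sub => [z|]; rewrite !inE // => /eqP->; rewrite sv.
have uNv : u \notin porbit s v by rewrite pv inE.
have := sum_porbits_tperm min_weight uNv.
rewrite -!/(cycle_weight _) pv min_weight_set1 min_weightU min_weight_set1.
have : Num.min (min_weight (porbit s u)) (lam v) <= min_weight (porbit s u).
  by rewrite ge_min lexx.
lra.
Qed.

(** A merge does not create more than one new minimum. In a split one part keeps the old minimum,
    and the minimum of the other is at most [W]. *)
Lemma cycle_weight_tperm s u v : u != v ->
  cycle_weight (tperm u v * s)%g <= cycle_weight s + W.
Proof.
move=> uv; have [uNv|uv'] := boolP (u \notin porbit s v).
  have := sum_porbits_tperm min_weight uNv.
  rewrite -!/(cycle_weight _).
  have := min_weight_leW (porbit s u :|: porbit s v).
  have W0 : 0 <= W := le_trans (lam_ge0 u) (lam_leW u).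
  have := min_weight_ge0 (porbit s u) W0.
  by have := min_weight_ge0 (porbit s v) W0; lra.
(* The split of a cycle of [s] is read backwards, as a merge of two cycles of [tperm u v * s]. *)
have uNv : u \notin porbit (tperm u v * s)%g v by rewrite mem_porbit_tperm.
have := sum_porbits_tperm min_weight uNv.
rewrite mulgA tperm2 mul1g -!/(cycle_weight _) min_weightU.
have := min_weight_leW (porbit (tperm u v * s) u).
have := min_weight_leW (porbit (tperm u v * s) v).
by rewrite minEle; case: ifP => _; lra.
Qed.

Lemma travel_weight_tperm s u v : u != v ->
  travel_weight (tperm u v * s)%g
    + ((gdist e u (s u))%:R * (lam (s u) + W)
       + (gdist e v (s v))%:R * (lam (s v) + W))
  = travel_weight s + ((gdist e v (s u))%:R * (lam (s u) + W)
       + (gdist e u (s v))%:R * (lam (s v) + W)).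
Proof.
move=> uv; rewrite /travel_weight (bigD1 u) //= (bigD1 v) //=; last first.
  by rewrite eq_sym.
rewrite [in RHS](bigD1 u) //= [in RHS](bigD1 v) //=; last by rewrite eq_sym.
rewrite !permM tpermL tpermR.
under eq_bigr => x /andP[xu xv] do rewrite permM tpermD 1?eq_sym //.
by ring.
Qed.

(* A swap moving both tokens closer lowers [travel_weight] enough to pay for a
   possible split of a cycle; if one of the tokens leaves its destination
   instead, two cycles merge, and this makes up for its detour. *)
Lemma potential_swap s u v :
    e u v -> (gdist e v (s u) < gdist e u (s u))%N ->
    (s v == v) || (gdist e u (s v) < gdist e v (s v))%N ->
  lam (s u) + lam (s v) + potential (tperm u v * s)%g <= potential s.
Proof.
move=> euv du dv.
have uv : u != v by apply: contraTneq du => ->; rewrite ltnn.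
have := travel_weight_tperm s uv; rewrite /potential.
have d1 : (gdist e v (s u))%:R + 1 <= (gdist e u (s u))%:R :> R.
  by rewrite natr1 ler_nat.
have W0 x : 0 <= lam x + W by apply: addr_ge0 => //; exact: le_trans (lam_leW x).
have m1 := ler_wpM2r (W0 (s u)) d1.
(* With [v] at home, travel falls by at least [lam (s u) + W], rises by at most [lam v + W], and the
   merge frees [2 * lam v]. Otherwise travel falls by at least [lam (s u) + lam (s v) + 2 * W],
   where [2 * W] covers a split. *)
case/orP: dv => [/eqP sv|dv].
  have d2 : (gdist e u v)%:R <= 1 :> R.
    by rewrite (ler_nat _ _ 1%N); have := gdist_adj conn v euv; rewrite gdistxx.
  have m2 := ler_wpM2r (W0 v) d2.
  rewrite sv gdistxx; have := cycle_weight_fixed uv sv; lra.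
have d2 : (gdist e u (s v))%:R + 1 <= (gdist e v (s v))%:R :> R.
  by rewrite natr1 ler_nat.
have m2 := ler_wpM2r (W0 (s v)) d2.
have := cycle_weight_tperm s uv; lra.
Qed.

(** The cycles partition [V], and the minimum over a cycle is at most the sum over it. The extra
    term is the potential of the identity, so it cancels at the end of a run. *)
Lemma potential_le s : potential s <= travel_weight s + 2 * \sum_x lam x.
Proof.
rewrite lerD2l ler_pM2l // /cycle_weight.
have -> : porbits s = porbit s @: [set: V].
  by apply/setP => B; apply/imsetP/imsetP => -[x _ ->]; exists x; rewrite ?inE.
have -> : \sum_x lam x = \sum_(x in [set: V]) lam x.
  by apply: eq_bigl => x; rewrite inE.
rewrite (partition_big_imset (porbit s)) /=.
apply: ler_sum => _ /imsetP[x _ ->]; rewrite (bigD1 x) ?inE ?eqxx //=.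
apply: le_trans (min_weight_le (porbit_id s x)) _.
by rewrite lerDl sumr_ge0.
Qed.

Lemma potential1 : potential 1%g = 2 * \sum_x lam x.
Proof.
rewrite /potential /travel_weight big1 => [|x _]; last first.
  by rewrite perm1 gdistxx mul0r.
rewrite add0r; congr (_ * _); rewrite /cycle_weight /porbits.
have p1 x : porbit 1 x = [set x].
  apply/setP => y; rewrite inE; apply/porbitP/eqP => [[i ->]|->].
    by rewrite expg1n perm1.
  by exists 0%N; rewrite expg0 perm1.
rewrite big_imset /= => [|x y _ _]; last by rewrite !p1 => /set1_inj.
by apply: eq_big => x; rewrite ?inE // p1 min_weight_set1.
Qed.

End Potential.

(** * Greedy runs and the optimum *)

Section Instance.
Variables (R : realType) (I : wts_instance R).
Local Notation V := (vertex I).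
Local Notation T := (token I).
Local Notation e := (@adj R I).
Implicit Types (s : {perm V}) (l : seq (V * V)) (u v x : V) (t : T).

(** Since [dest] is bijective the sum has exactly one term; this form needs no inverse of [dest]. *)
Definition home_weight x : R := \sum_(t | dest t == x) weight t.

Lemma home_weight_dest t : home_weight (dest t) = weight t.
Proof.
rewrite /home_weight (big_pred1 t) // => t'.
by rewrite (inj_eq (bij_inj (@dest_bij R I))).
Qed.

Lemma dest_surj x : exists t, x = dest t.
Proof. by have [g _ gK] := @dest_bij R I; exists (g x); rewrite gK. Qed.

Lemma start_perm_ex : exists s, forall t, s (start t) = dest t.
Proof.
have [g Kg gK] := @start_bij R I.
have inj : injective (@dest R I \o g).
  exact: inj_comp (bij_inj (@dest_bij R I)) (can_inj gK).
by exists (perm inj) => t; rewrite permE /= Kg.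
Qed.

Lemma swap_cost_perm (f : T -> V) s u v : u != v ->
    (forall t, s (f t) = dest t) ->
  swap_cost f (u, v) = home_weight (s u) + home_weight (s v).
Proof.
move=> uv sf; have fE t x : (f t == x) = (dest t == s x).
  by rewrite -sf (inj_eq perm_inj).
rewrite /swap_cost (bigID (fun t => dest t == s u)) /=; congr (_ + _).
  by apply: eq_bigl => t; rewrite !fE; case: (_ == s u); rewrite ?orbT ?andbF.
apply: eq_bigl => t; rewrite !fE; have [->|_] := eqVneq (dest t) (s u).
  by rewrite (inj_eq perm_inj) (negPf uv).
by rewrite andbT.
Qed.

Lemma cost_rcons l u v :
  cost (rcons l (u, v)) = cost l + swap_cost (placement_after l) (u, v).
Proof.
rewrite /cost /placement_after; elim: l (@start R I) => [|a l IH] f /=.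
  by rewrite addr0 add0r.
by rewrite IH addrA.
Qed.

Section Run.
Variable W : R.
Hypothesis weight_leW : forall t, weight t <= W.
Variable s0 : {perm V}.
Hypothesis s0P : forall t, s0 (start t) = dest t.

Let pot := potential e home_weight W.
Let pot1 := potential e (fun _ => 1 : R) 1.

Lemma home_weight_ge0 x : 0 <= home_weight x.
Proof.
by have [t ->] := dest_surj x; rewrite home_weight_dest ltW ?weight_gt0.
Qed.

Lemma home_weight_leW x : home_weight x <= W.
Proof. by have [t ->] := dest_surj x; rewrite home_weight_dest. Qed.

(** The run is charged to two potentials: the true weights bound its cost, unit weights its length.
    A swap costs [1 + 1] with unit weights, hence the factor 2. *)
Record greedy_run l s : Prop := GreedyRun {
  run_adj : all (fun a => e a.1 a.2) l;
  run_perm : forall t, s (placement_after l t) = dest t;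
  run_cost : cost l + pot s <= pot s0;
  run_size : 2 * (size l)%:R + pot1 s <= pot1 s0
}.

Lemma greedy_run_start : greedy_run [::] s0.
Proof. by split=> //; rewrite ?mulr0 add0r. Qed.

Lemma greedy_run_swap l s u v : greedy_run l s ->
    e u v -> (gdist e v (s u) < gdist e u (s u))%N ->
    (s v == v) || (gdist e u (s v) < gdist e v (s v))%N ->
  greedy_run (rcons l (u, v)) (tperm u v * s)%g.
Proof.
move=> [ladj lperm lcost lsize] uv du dv.
have neq_uv : u != v by apply: contraTneq uv => ->; rewrite adj_irr.
split.
- by rewrite all_rcons /= uv.
- move=> t; rewrite /placement_after foldl_rcons /swap_tokens /= permM tpermK.
  exact: lperm.
- rewrite cost_rcons (swap_cost_perm neq_uv lperm).
  have := potential_swap (@adj_connected R I) home_weight_ge0 home_weight_leW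
    uv du dv.
  by move: lcost; rewrite /pot; lra.
- have := @potential_swap R V e (fun _ => 1) 1 (@adj_connected R I)
    (fun _ => ler01) (fun _ => lexx 1) _ _ _ uv du dv.
  rewrite size_rcons -natr1; move: lsize; rewrite /pot1; lra.
Qed.

(** Distances are at most [#|V| - 1], so [pot1 s0] is at most [2 * #|V| * (#|V| - 1) + 2 * #|V|],
    twice the square, while [pot1 s] is nonnegative. *)
Lemma greedy_run_size l s : greedy_run l s -> (size l <= #|V| * #|V|)%N.
Proof.
move=> [_ _ _ lsize]; rewrite -(ler_nat R).
have p0 : 0 <= pot1 s.
  apply: addr_ge0; first by apply: sumr_ge0 => x _; rewrite mulr_ge0 ?ler0n ?addr_ge0.
  apply: mulr_ge0 => //; apply: sumr_ge0 => B _.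
  by apply: min_weight_ge0 => // x; exact: ler01.
have := @potential_le R V e (fun _ => 1) 1 (fun _ => ler01) s0.
rewrite sumr_const -/(pot1 s0) -[#|_|]/#|V| => p1.
have : travel_weight e (fun _ => 1 : R) 1 s0 <= \sum_(x : V) 2 * (#|V|.-1)%:R.
  apply: ler_sum => x _; rewrite /= mulrC ler_pM2l ?addr_gt0 // ler_nat.
  have lt := gdist_lt_card (@adj_connected R I) x (s0 x).
  by rewrite -ltnS (ltn_predK lt).
rewrite sumr_const -mulrnAr -mulrnA.
case: #|V| p1 => [|n] p1 p2.
  by move: p1 p2; rewrite mul0n; lra.
move: p1 p2; rewrite /= mulSn natrD mulnC; lra.
Qed.

Lemma greedy_run_end l : greedy_run l 1%g ->
  valid_solution l /\ cost l <= travel_weight e home_weight W s0.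
Proof.
move=> [ladj lperm lcost lsize]; split.
  by split=> // t; rewrite -(lperm t) perm1.
have := @potential_le R V e _ W home_weight_ge0 s0.
by move: lcost; rewrite /pot potential1 //; [lra | exact: home_weight_leW].
Qed.

End Run.

(** * Lower bound for all solutions and existence of the optimum *)

Definition travel_cost : R :=
  \sum_t (gdist e (start t) (dest t))%:R * weight t.

(** A swap brings each of its two tokens at most one edge closer, and each pays its own weight. The
    induction generalizes the starting placement. *)
Lemma valid_solution_cost_ge l : valid_solution l -> travel_cost <= cost l.
Proof.
rewrite /valid_solution /placement_after /cost /travel_cost => -[].
elim: l (@start R I) => [|[u v] l IH] f /=.
  move=> _ fP; rewrite big1 // => t _.
  by rewrite fP gdistxx mul0r.
case/andP=> uv ladj lP; apply: le_trans (lerD (lexx _) (IH _ ladj lP)).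
rewrite /swap_cost [X in _ <= X + _]big_mkcond -big_split /=; apply: ler_sum => t _.
rewrite /swap_tokens /=; have w0 := ltW (weight_gt0 t).
have -> : (if (f t == u) || (f t == v) then weight t else 0)
     = ((f t == u) || (f t == v))%:R * weight t.
  by case: ifP; rewrite ?mul1r ?mul0r.
rewrite -mulrDl ler_wpM2r // -natrD ler_nat.
have [->|nu] := eqVneq (f t) u.
  by rewrite tpermL add1n; apply: gdist_adj uv; exact: adj_connected.
have [->|nv] := eqVneq (f t) v; last by rewrite tpermD 1?eq_sym.
by rewrite tpermR add1n; apply: gdist_adj; rewrite 1?adj_sym //;
  exact: adj_connected.
Qed.

(** Token by token, [w <= weight t] gives [W <= W / w * weight t]. *)
Lemma travel_weight_le s0 w W : (forall t, s0 (start t) = dest t) ->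
    0 < w -> (forall t, w <= weight t) -> (forall t, weight t <= W) ->
  travel_weight e home_weight W s0 <= (1 + W / w) * travel_cost.
Proof.
move=> s0P w0 wle leW; rewrite /travel_weight /travel_cost.
rewrite (reindex (@start R I)) /=; last by apply: onW_bij; exact: start_bij.
rewrite mulr_sumr; apply: ler_sum => t _; rewrite s0P home_weight_dest.
rewrite [leRHS]mulrCA ler_wpM2l ?ler0n // mulrDl mul1r lerD2l.
rewrite -mulrA ler_peMr //; first exact: le_trans (ltW (weight_gt0 t)) (leW t).
by rewrite mulrC ler_pdivlMr // mul1r.
Qed.

(** Every swap costs at least [w], so solutions no costlier than [l0] have bounded length. They form
    a finite set, over which a minimum is attained. *)
Lemma is_OPT_ex l0 (w : R) : 0 < w -> (forall t, w <= weight t) ->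
  valid_solution l0 -> exists opt : R, is_OPT I opt.
Proof.
move=> w0 wle l0P.
have size_le l : w * (size l)%:R <= cost l.
  rewrite /cost; have := bij_inj (@start_bij R I).
  (* Surjectivity provides a token on the endpoint [u] of each swap, which alone costs at least
     [w]. *)
  have : forall x, exists t, start t = x.
    by case: (@start_bij R I) => g _ gK x; exists (g x).
  elim: l (@start R I) => [|[u v] l IH] f fsurj finj /=; first by rewrite mulr0.
  rewrite -nat1r mulrDr mulr1 lerD //.
    have [t ft] := fsurj u; rewrite /swap_cost (bigD1 t) /= ?ft ?eqxx //.
    by rewrite (le_trans (wle t)) // lerDl sumr_ge0 // => t' _; exact: ltW (weight_gt0 t').
  apply: IH => [x|].
    by have [t ft] := fsurj (tperm u v x); exists t; rewrite /swap_tokens ft tpermK.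
  exact: inj_comp perm_inj finj.
pose N := Num.bound (cost l0 / w).
have size_leN l : cost l <= cost l0 -> (size l <= N)%N.
  move=> cl; rewrite -(ler_nat R) ltW //.
  apply: le_lt_trans (archi_boundP _).
    by rewrite ler_pdivlMr // mulrC (le_trans (size_le l)).
  by rewrite divr_ge0 ?(ltW w0) // (le_trans _ (size_le l0)) // mulr_ge0 // ltW.
pose P (b : {bseq N of V * V}) := `[< valid_solution b >].
pose b0 : {bseq N of V * V} := Bseq (size_leN _ (lexx (cost l0))).
have Pb0 : P b0 by apply/asboolP.
case: (arg_minP (fun b : {bseq N of V * V} => cost b) Pb0) => b /asboolP bP bmin.
exists (cost b); split; first by exists (b : seq _).
move=> _ [l lP <-]; have [lt|le] := ltP (cost l0) (cost l).
  exact: le_trans (bmin b0 Pb0) (ltW lt).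
by apply: (bmin (Bseq (size_leN l le))); apply/asboolP.
Qed.

End Instance.

(** * Loop programs *)

Section Loops.
Local Open Scope nat_scope.

(* The bound of every loop is the number of vertices, read from cell 0 of
   array 0; cell 0 of the named array is the loop counter. *)
Inductive cmd :=
| CSet of nat & nexp & nexp
| CSeq of cmd & cmd
| CIf of bexp & cmd
| CFor of nat & cmd.

Fixpoint compile (c : cmd) : program :=
  match c with
  | CSet a i e => NSet a i e
  | CSeq c1 c2 => Seq (compile c1) (compile c2)
  | CIf b c => If b (compile c) Skip
  | CFor a c =>
      Seq (NSet a (NConst 0) (NConst 0))
        (While (BNot (BNLe (NGet 0 (NConst 0)) (NGet a (NConst 0))))
           (Seq (compile c)
              (NSet a (NConst 0) (NAdd (NGet a (NConst 0)) (NConst 1)))))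
  end.

Fixpoint writes (c : cmd) (a : nat) : bool :=
  match c with
  | CSet b _ _ => a == b
  | CSeq c1 c2 => writes c1 a || writes c2 a
  | CIf _ c => writes c a
  | CFor b c => (a == b) || writes c a
  end.

(** Array 0 stays constant and no body touches its own counter, so every loop makes exactly the
    number of rounds stored in cell 0 of array 0. *)
Fixpoint well_formed (c : cmd) : bool :=
  match c with
  | CSet a _ _ => a != 0
  | CSeq c1 c2 => well_formed c1 && well_formed c2
  | CIf _ c => well_formed c
  | CFor a c => [&& a != 0, ~~ writes c a & well_formed c]
  end.

(** A loop pays one step for the reset, two per round for test and increment, and one for the last,
    failing test. *)
Fixpoint time_bound (c : cmd) : {poly nat} :=
  match c with
  | CSet _ _ _ => 1%R
  | CSeq c1 c2 => (time_bound c1 + time_bound c2)%R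
  | CIf _ c => (time_bound c + 1)%R
  | CFor _ c => (1 + ('X * (time_bound c + 1 + 1) + 1))%R
  end.

Variable R : realType.
Implicit Types (s : store R) (c : cmd).

Definition set_cell s a i x : store R := Store (update (nmem s) a i x) (rmem s).

Definition incr_cell s a := set_cell s a 0 (nmem s a 0 + 1).

Arguments set_cell : simpl never.
Arguments incr_cell : simpl never.

(** A total meaning for commands, so that correctness can be proved without [exec]. *)
Fixpoint den (c : cmd) s : store R :=
  match c with
  | CSet a i e => set_cell s a (neval s i) (neval s e)
  | CSeq c1 c2 => den c2 (den c1 s)
  | CIf b c => if beval s b then den c s else s
  | CFor a c => iter (nmem s 0 0) (fun s => incr_cell (den c s) a)
                     (set_cell s a 0 0)
  end.

Lemma set_cell_same s a i x : nmem (set_cell s a i x) a i = x.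
Proof. by rewrite /set_cell /= /update !eqxx. Qed.

Lemma set_cell_other s a i x b : b != a -> nmem (set_cell s a i x) b = nmem s b.
Proof.
by move=> /negPf ba; apply: functional_extensionality_dep => j;
  rewrite /set_cell /= /update ba.
Qed.

Lemma den_frame c s a : ~~ writes c a -> nmem (den c s) a = nmem s a.
Proof.
elim: c s => [b i e|c1 IH1 c2 IH2|b c IH|b c IH] s /=.
- exact: set_cell_other.
- by rewrite negb_or => /andP[n1 n2]; rewrite IH2 // IH1.
- by move=> na; case: ifP => // _; exact: IH.
- rewrite negb_or => /andP[ab na]; rewrite -(set_cell_other s 0 0 ab).
  elim: (nmem s 0 0) => // k IHk.
  by rewrite iterS /incr_cell set_cell_other // IH.
Qed.

Lemma well_formed_writes0 c : well_formed c -> ~~ writes c 0.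
Proof.
elim: c => [a i e|c1 IH1 c2 IH2|b c IH|a c IH] //=; first by rewrite eq_sym.
  by case/andP=> /IH1 ? /IH2 ?; rewrite negb_or; apply/andP.
by case/and3P=> a0 _ /IH ?; rewrite negb_or eq_sym a0.
Qed.

Lemma den_bound c s : well_formed c -> nmem (den c s) 0 0 = nmem s 0 0.
Proof. by move=> /well_formed_writes0 w; rewrite den_frame. Qed.

Lemma exec_den n c s : well_formed c -> nmem s 0 0 = n ->
  exists2 k, exec (compile c) s k (den c s) & k <= (time_bound c).[n]%R.
Proof.
elim: c s => [a i e|c1 IH1 c2 IH2|b c IH|a c IH] s.
- by move=> _ _; exists 1; [exact: ExecNSet | rewrite hornerE].
- case/andP=> wf1 wf2 s0; have [k1 e1 b1] := IH1 s wf1 s0.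
  have [|k2 e2 b2] := IH2 (den c1 s) wf2; first by rewrite den_bound.
  by exists (k1 + k2); [exact: ExecSeq e1 e2 | rewrite hornerD leq_add].
- move=> wfc s0; have [k ek bk] := IH s wfc s0.
  rewrite hornerD hornerC /=; case: ifP => bs.
    by exists k.+1; [apply: ExecIf; rewrite bs | rewrite -addn1 leq_add].
  by exists 1; [apply: ExecIf; rewrite bs; exact: ExecSkip | exact: leq_addl].
- case/and3P=> a0 na wfc s0 /=; rewrite s0.
  set w := While _ _; set T := (time_bound c).[n]%R in IH *.
  pose step s := incr_cell (den c s) a.
  have step0 s' : nmem (step s') 0 0 = nmem s' 0 0.
    by rewrite /step /incr_cell set_cell_other 1?eq_sym // den_bound.
  (* Here [i] is the counter and [j] the number of rounds left. *)
  have loop j i s' : i + j = n -> nmem s' 0 0 = n -> nmem s' a 0 = i ->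
      exists2 k, exec w s' k (iter j step s') & k <= j * (T + 1 + 1) + 1.
    elim: j i s' => [|j IHj] i s' ij s'0 s'a.
      exists 1 => //; apply: ExecWhileFalse.
      by rewrite /= s'0 s'a -ij addn0 negbK.
    have [k1 e1 b1] := IH s' wfc s'0.
    have [|||k2 e2 b2] := IHj i.+1 (step s').
    - by rewrite addSnnS.
    - by rewrite step0.
    - by rewrite /step /incr_cell set_cell_same den_frame // s'a addn1.
    exists (k1 + 1 + k2).+1.
      rewrite iterSr; apply: ExecWhileTrue e2; first by rewrite /= s'0 s'a; lia.
      exact: ExecSeq e1 (ExecNSet _ _ _ _).
    by rewrite mulSn; lia.
  have [|||k ek bk] := loop n 0 (set_cell s a 0 0).
  - by [].
  - by rewrite set_cell_other // eq_sym.
  - exact: set_cell_same.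
  exists (1 + k).
    by apply: (ExecSeq _ ek); exact: ExecNSet.
  by rewrite !hornerE.
Qed.

(** [Inv] has to tolerate writes to the counter because its reset and increments lie outside [c]. *)
Lemma for_rule (n a : nat) c s (Inv : nat -> store R -> Prop) :
    well_formed (CFor a c) -> nmem s 0 0 = n ->
    (forall i x s, Inv i s -> Inv i (set_cell s a 0 x)) ->
    (forall i s, i < n -> nmem s a 0 = i -> Inv i s -> Inv i.+1 (den c s)) ->
  Inv 0 s -> Inv n (den (CFor a c) s).
Proof.
case/and3P=> a0 na wfc s0 stable step inv0 /=; rewrite s0.
have : forall k, k <= n ->
    let s' := iter k (fun s => incr_cell (den c s) a) (set_cell s a 0 0) in
    nmem s' a 0 = k /\ Inv k s'.
  elim=> [|k IH] kn.
    by split; [exact: set_cell_same | exact: stable].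
  have [ck ik] := IH (ltnW kn); split; last exact/stable/step.
  by rewrite iterS /incr_cell set_cell_same den_frame // ck addn1.
by move=> /(_ n (leqnn n)) [].
Qed.

(** For loops whose round [i] establishes a fact [Q i] that later rounds preserve: states only grow
    along the preorder [le], and [Q i] is monotone in it. *)
Lemma for_sweep (n a : nat) c s (Inv : store R -> Prop)
    (le : store R -> store R -> Prop) (Q : nat -> store R -> Prop) :
    well_formed (CFor a c) -> nmem s 0 0 = n ->
    (forall s, le s s) ->
    (forall s1 s2 s3, le s1 s2 -> le s2 s3 -> le s1 s3) ->
    (forall x s, le s (set_cell s a 0 x)) ->
    (forall x s, Inv s -> Inv (set_cell s a 0 x)) ->
    (forall i s1 s2, le s1 s2 -> Q i s1 -> Q i s2) ->
    (forall i s, i < n -> nmem s a 0 = i -> Inv s ->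
       [/\ Inv (den c s), le s (den c s) & Q i (den c s)]) ->
  Inv s ->
  [/\ Inv (den (CFor a c) s), le s (den (CFor a c) s)
    & forall i, i < n -> Q i (den (CFor a c) s)].
Proof.
move=> wf s0 le_refl le_trans le_cell Inv_cell Q_le step inv.
have [] := @for_rule n a c s (fun i s' => [/\ Inv s', le s s'
  & forall j, j < i -> Q j s']) wf s0.
- move=> i x s' [inv' le' q']; split; first exact: Inv_cell.
    exact: le_trans le' (le_cell _ _).
  by move=> j /q'; exact/Q_le/le_cell.
- move=> i s' lt_in s'a [inv' le' q'].
  have [inv2 le2 q2] := step i s' lt_in s'a inv'.
  split=> //; first exact: le_trans le' le2.
  move=> j; rewrite ltnS leq_eqVlt => /orP[/eqP->//|/q'].
  exact: Q_le.
- by split.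
by [].
Qed.

End Loops.

(** * The algorithm *)

Section Algorithm.
Local Open Scope nat_scope.

Definition cell (a : nat) : nexp := NGet a (NConst 0).

(* Array 7 holds the row offsets, array 8 the matrix [n - gdist u z] ([0]
   initially, where [n] is the number of vertices), array 9 the destination of
   the token on each vertex; arrays 10 to 15 are loop counters and array 16 is
   temporary. *)
Definition entry (a : nat) (u z : nexp) : nexp := NGet a (NAdd (NGet 7 u) z).

(** Without multiplication, row offsets are built by repeated addition. The counter numbers vertices
    and, in the last assignment, the equally many tokens. *)
Definition init_cmd : cmd :=
  let i := cell 10 in
  CFor 10 (CSeq (CSet 8 (NAdd (NGet 7 i) i) (cell 0))
          (CSeq (CSet 7 (NAdd i (NConst 1)) (NAdd (NGet 7 i) (cell 0)))
                (CSet 9 (NGet 2 i) (NGet 3 i)))).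

(** A Bellman-Ford relaxation. With [n - d] stored instead of [d], a cell still 0 means that no walk
    is known, and a longer walk is a truncated decrement. *)
Definition relax_cmd : cmd :=
  let: (u, z, v) := (cell 12, cell 13, cell 14) in
  CIf (BAnd (BNLe (NConst 1) (entry 1 u v))
            (BNot (BNLe (NSub (entry 8 v z) (NConst 1)) (entry 8 u z))))
    (CSet 8 (NAdd (NGet 7 u) z) (NSub (entry 8 v z) (NConst 1))).

Definition dist_cmd : cmd := CFor 11 (CFor 12 (CFor 13 (CFor 14 relax_cmd))).

Definition swap_cmd : cmd :=
  let: (u, v, k) := (cell 12, cell 13, cell 4) in
  CSeq (CSet 5 k u) (CSeq (CSet 6 k v)
    (CSeq (CSet 4 (NConst 0) (NAdd k (NConst 1)))
    (CSeq (CSet 16 (NConst 0) (NGet 9 u))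
    (CSeq (CSet 9 u (NGet 9 v)) (CSet 9 v (cell 16)))))).

(** A larger entry of array 8 means closer. Disjunction and equality are expressed by negation,
    conjunction and [BNLe]. *)
Definition enabled : bexp :=
  let: (u, v) := (cell 12, cell 13) in
  BAnd (BNLe (NConst 1) (entry 1 u v))
    (BAnd (BNot (BNLe (entry 8 v (NGet 9 u)) (entry 8 u (NGet 9 u))))
      (BNot (BAnd (BNot (BAnd (BNLe (NGet 9 v) v) (BNLe v (NGet 9 v))))
                  (BNLe (entry 8 u (NGet 9 v)) (entry 8 v (NGet 9 v)))))).

Definition sweep_cmd : cmd := CFor 12 (CFor 13 (CIf enabled swap_cmd)).

(** The two outer loops make [n * n] sweeps, the bound on the number of swaps in a greedy run. *)
Definition algorithm : cmd :=
  CSeq init_cmd (CSeq dist_cmd (CFor 14 (CFor 15 sweep_cmd))).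

Lemma algorithm_wf : well_formed algorithm. Proof. by []. Qed.

Local Notation number := Defs.number.

Lemma number_inj (X : finType) : injective (@number X).
Proof.
move=> x y eqn; rewrite -(nth_index x (mem_enum X x)) -/(number x) eqn.
by rewrite nth_index ?mem_enum.
Qed.

Lemma number_lt (X : finType) (x : X) : number x < #|X|.
Proof. by rewrite cardE index_mem mem_enum. Qed.

Lemma number_surj (X : finType) i : i < #|X| -> exists x : X, i = number x.
Proof.
move=> lt; have /card_gt0P[x0 _] := leq_ltn_trans (leq0n i) lt.
exists (nth x0 (enum X) i).
by rewrite /number index_uniq ?enum_uniq // -cardE.
Qed.

Lemma nth_map_number (X : finType) (A : Type) (a0 : A) (f : X -> A) (x : X) :
  nth a0 [seq f y | y <- enum X] (number x) = f x.
Proof.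
by rewrite (nth_map x) -?cardE ?number_lt // nth_index ?mem_enum.
Qed.

Lemma nth_allpairs_index (X Y : eqType) (A : Type) (a0 : A) (f : X -> Y -> A)
    (s : seq X) (r : seq Y) (x : X) (y : Y) : x \in s -> y \in r ->
  nth a0 [seq f x y | x <- s, y <- r] (index x s * size r + index y r) = f x y.
Proof.
move=> xs yr; elim: s xs => // x' s IH; rewrite inE /= nth_cat size_map.
rewrite eq_sym; have [<- _|_ /= xs] := eqVneq x' x.
  by rewrite add0n index_mem yr (nth_map y) ?index_mem // nth_index.
by rewrite mulSn -addnA ltnNge leq_addr /= addKn IH.
Qed.

Variables (R : realType) (I : wts_instance R).
Local Notation V := (vertex I).
Local Notation T := (token I).
Local Notation e := (@adj R I).
Implicit Types (s : store R) (u v z : V) (t : T) (l : seq (V * V)).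

Local Notation n := #|V|.
Local Notation d := (gdist e).

Lemma entry_inj u z u' z' :
  number u * n + number z = number u' * n + number z' -> u = u' /\ z = z'.
Proof.
move=> eqn; have n0 : 0 < n := leq_ltn_trans (leq0n _) (number_lt u).
have eu : number u = number u'.
  have := congr1 (divn^~ n) eqn.
  by rewrite /= !divnMDl // !divn_small ?number_lt ?addn0.
by split; apply: number_inj => //; move: eqn; rewrite eu => /addnI.
Qed.

Definition static s :=
  [/\ nmem s 0 0 = n,
      forall u v, nmem s 1 (number u * n + number v) = e u v
    & forall u, nmem s 7 (number u) = number u * n].

Lemma init_correct (s := den init_cmd (input_store I)) :
  [/\ static s,
      forall u z, nmem s 8 (number u * n + number z) = (if u == z then n else 0),
      forall t, nmem s 9 (number (start t)) = number (dest t)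
    & nmem s 4 0 = 0].
Proof.
rewrite /s {s}; set s0 := input_store I.
(* Offsets are known up to [i] inclusive, because round [i] writes the one of row [i + 1]; row 0 has
   the initial value 0. *)
pose Inv i s := [/\ nmem s 0 0 = n, nmem s 2 = nmem s0 2, nmem s 3 = nmem s0 3,
  forall j, j <= i -> nmem s 7 j = j * n
  & (forall u z, nmem s 8 (number u * n + number z)
       = (if (u == z) && (number u < i) then n else 0))
    /\ (forall t, number t < i -> nmem s 9 (number (start t)) = number (dest t))].
have [] : Inv n (den init_cmd s0).
  apply: for_rule => //.
    move=> i s lt_in si [s_0 s_2 s_3 s_7 [s_8 s_9]].
    have cardT : #|T| = n by exact: bij_eq_card (@start_bij R I).
    have [u iu] := number_surj lt_in.
    have [|t it] := @number_surj T i; first by rewrite cardT.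
    rewrite /= /incr_cell /set_cell /= /update /= si s_2 s_3 s_0 s_7 //.
    rewrite /Inv /=; split=> //.
    - move=> j ji; rewrite addn1; case: eqP => [->|ne]; first by rewrite mulSn addnC.
      by rewrite s_7 //; lia.
    - split.
        move=> x z; rewrite iu; case: eqP => [/entry_inj[-> ->]|ne].
          by rewrite eqxx ltnS leqnn.
        rewrite s_8; case: eqP => //= xz; congr (if _ then _ else _).
        rewrite iu ltnS [in RHS]leq_eqVlt; case: eqP => // /number_inj xu.
        by case: ne; rewrite -xz xu.
      move=> t'; rewrite it /= !nth_map_number ltnS leq_eqVlt.
      have [eqn|ne] := eqVneq (number (start t')) (number (start t)).
        by rewrite (bij_inj (@start_bij R I) (number_inj eqn)).
      case/orP=> [/eqP/number_inj tt'|lt]; first by rewrite tt' eqxx in ne.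
      by apply: s_9; rewrite it.
  split=> //.
    by case=> // _; rewrite mul0n.
  by split=> // u z; rewrite /= ltn0 andbF nth_nil.
move=> s_0 s_2 s_3 s_7 [s_8 s_9]; split.
- split=> // [u v|u]; last by rewrite s_7 // ltnW // number_lt.
  rewrite den_frame //= [n]cardE.
  by rewrite nth_allpairs_index ?mem_enum.
- by move=> u z; rewrite s_8 number_lt andbT.
- move=> t; apply: s_9; rewrite -(bij_eq_card (@start_bij R I)).
  exact: number_lt.
- by rewrite den_frame.
Qed.

Lemma static_cell s (a x : nat) : a \notin [:: 0; 1; 7] ->
  static s -> static (set_cell s a 0 x).
Proof.
rewrite !inE !negb_or => /and3P[a0 a1 a7] [s_0 s_1 s_7].
by split=> [|u v|u]; rewrite set_cell_other // eq_sym.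
Qed.

Lemma static_den c s : [&& ~~ writes c 0, ~~ writes c 1 & ~~ writes c 7] ->
  static s -> static (den c s).
Proof.
by move=> /and3P[c0 c1 c7] [s_0 s_1 s_7]; split=> [|u v|u]; rewrite den_frame.
Qed.

(** * Correctness of the distance computation *)

Definition prox s u z := nmem s 8 (number u * n + number z).

(** Updates in place may run ahead of the round, so beyond distance [k] only the upper bound is
    claimed. *)
Definition dist_ok k s :=
  forall u z, prox s u z <= n - d u z /\ (d u z <= k -> n - d u z <= prox s u z).

Definition prox_le s s' := forall u z, prox s u z <= prox s' u z.

Lemma prox_le_trans s1 s2 s3 : prox_le s1 s2 -> prox_le s2 s3 -> prox_le s1 s3.
Proof. by move=> le12 le23 u z; exact: leq_trans (le12 u z) (le23 u z). Qed.

Lemma prox_cell s (a x : nat) u z : a != 8 -> prox (set_cell s a 0 x) u z = prox s u z.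
Proof. by move=> a8; rewrite /prox set_cell_other // eq_sym. Qed.

Lemma prox_le_cell s (a x : nat) : a != 8 -> prox_le s (set_cell s a 0 x).
Proof. by move=> a8 u z; rewrite prox_cell. Qed.

Lemma relax_correct k s u z v :
    static s -> dist_ok k s ->
    nmem s 12 0 = number u -> nmem s 13 0 = number z -> nmem s 14 0 = number v ->
  let s' := den relax_cmd s in
  [/\ dist_ok k s', prox_le s s'
    & e u v -> d v z <= k -> n - k.+1 <= prox s' u z].
Proof.
have arith m dv p q : dv <= k -> p - 1 <= q -> m - dv <= p -> m - k.+1 <= q.
  by lia.
have arith2 m du dv p : du <= dv.+1 -> p <= m - dv -> p - 1 <= m - du by lia.
move=> [s_0 s_1 s_7] ok su sz sv /=.
rewrite su sz sv !s_7 s_1 -/(prox s v z) -/(prox s u z).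
case: ifP => [/andP[euv lt]|nlt]; last first.
  split=> // euv dvz; move: nlt; rewrite euv /= => /negbFE le.
  exact: arith dvz le (proj2 (ok v z) dvz).
have {}euv : e u v by case: (e u v) euv.
set s' := set_cell _ _ _ _.
have s'E x y : prox s' x y
    = if (x == u) && (y == z) then prox s v z - 1 else prox s x y.
  rewrite /prox /s' /set_cell /= /update /=.
  case: eqP => [/entry_inj[-> ->]|ne]; first by rewrite !eqxx.
  by case: andP => // -[/eqP xu /eqP yz]; case: ne; rewrite xu yz.
have le : prox_le s s'.
  move=> x y; rewrite s'E; case: andP => // -[/eqP-> /eqP->].
  by apply: ltnW; rewrite ltnNge.
have duv : d u z <= (d v z).+1 by apply: gdist_adj euv; exact: adj_connected.
split=> //.
  move=> x y; have [up lo] := ok x y; split; last by move=> /lo/leq_trans; apply.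
  rewrite s'E; case: andP => // -[/eqP-> /eqP->].
  exact: arith2 duv (proj1 (ok v z)).
move=> _ dvz; rewrite s'E !eqxx /=.
exact: arith dvz (leqnn _) (proj2 (ok v z) dvz).
Qed.

(** The nested sweeps collect the effect [Q] of all relaxations. A pair at distance [k.+1] is then
    settled by a next hop, which is at distance [k]. *)
Lemma dist_step k s (s' := den (CFor 12 (CFor 13 (CFor 14 relax_cmd))) s) :
  static s -> dist_ok k s -> dist_ok k.+1 s'.
Proof.
move=> st ok; rewrite /s'.
pose Q u z v s := e u v -> d v z <= k -> n - k.+1 <= prox s u z.
have Qle u z v s1 s2 : prox_le s1 s2 -> Q u z v s1 -> Q u z v s2.
  by move=> le q euv dvz; exact: leq_trans (q euv dvz) (le u z).
pose Inv s := static s /\ dist_ok k s.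
have Inv_cell a x s1 : a \notin [:: 0; 1; 7] -> a != 8 -> Inv s1 ->
    Inv (set_cell s1 a 0 x).
  move=> a017 a8 [st1 ok1]; split; first exact: static_cell.
  by move=> u z; rewrite prox_cell.
have [] := @for_sweep R n 12 (CFor 13 (CFor 14 relax_cmd)) s Inv prox_le
    (fun i s => forall u z v, i = number u -> Q u z v s).
- by [].
- by case: st.
- by move=> ? ? ?.
- exact: prox_le_trans.
- by move=> x s1; exact: prox_le_cell.
- by move=> x s1; exact: Inv_cell.
- by move=> i s1 s2 le q u z v iu; exact: Qle le (q u z v iu).
- move=> i s1 lti s1i [st1 ok1]; have [u iu] := number_surj lti.
  have [] := @for_sweep R n 13 (CFor 14 relax_cmd) s1
      (fun s => Inv s /\ nmem s 12 0 = number u) prox_le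
      (fun j s => forall z v, j = number z -> Q u z v s).
  + by [].
  + by case: st1.
  + by move=> ? ? ?.
  + exact: prox_le_trans.
  + by move=> x s2; exact: prox_le_cell.
  + by move=> x s2 [inv s2u]; split; [exact: Inv_cell|rewrite set_cell_other].
  + by move=> j s2 s3 le q z v jz; exact: Qle le (q z v jz).
  + move=> j s2 ltj s2j [[st2 ok2] s2u]; have [z jz] := number_surj ltj.
    have [] := @for_sweep R n 14 relax_cmd s2
        (fun s => [/\ Inv s, nmem s 12 0 = number u & nmem s 13 0 = number z])
        prox_le (fun i s => forall v, i = number v -> Q u z v s).
    * by [].
    * by case: st2.
    * by move=> ? ? ?.
    * exact: prox_le_trans.
    * by move=> x s3; exact: prox_le_cell.
    * move=> x s3 [inv s3u s3z].
      by split; [exact: Inv_cell|rewrite set_cell_other..].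
    * by move=> i' s3 s4 le q v iv; exact: Qle le (q v iv).
    * move=> i' s3 lti' s3i [[st3 ok3] s3u s3z]; have [v iv] := number_surj lti'.
      have [|ok4 le4 q4] := relax_correct (v := v) st3 ok3 s3u s3z.
        by rewrite s3i.
      split=> //; last by move=> v'; rewrite iv => /number_inj<-.
      by split; [split=> //; exact: static_den|rewrite den_frame..].
    * by split=> //; rewrite s2j.
    move=> [inv s3u _] le3 q3; split=> // z' v'; rewrite jz => /number_inj<-.
    exact: q3 (number_lt v') v' erefl.
  + by split=> //; rewrite s1i.
  move=> [inv _] le3 q3; split=> // u' z' v'; rewrite iu => /number_inj<-.
  exact: q3 (number_lt z') z' v' erefl.
- by split.
move=> [st' ok'] le q u z; have [up lo] := ok' u z; split=> // duz.
have [/lo//|gt] := leqP (d u z) k; have {gt}duz : d u z = k.+1 by lia.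
have [|v euv dv] := @gdist_next V e (@adj_connected R I) u z.
  by apply: contra_eq_neq duz => ->; rewrite gdistxx.
rewrite duz; apply: (q _ (number_lt u) u z v erefl euv).
by move: duz; rewrite dv => -[->].
Qed.

(** Initially the pairs at distance 0 are settled, and [n] rounds suffice because all distances are
    below [n]. *)
Lemma dist_correct s : static s ->
    (forall u z, prox s u z = if u == z then n else 0) ->
  forall u z, prox (den dist_cmd s) u z = n - d u z.
Proof.
move=> st s8.
have [|||||_ ok] := @for_rule R n 11 (CFor 12 (CFor 13 (CFor 14 relax_cmd))) s
    (fun k s => static s /\ dist_ok k s).
- by [].
- by case: st.
- move=> k x s1 [st1 ok1]; split; first exact: static_cell.
  by move=> u z; rewrite prox_cell.
- move=> k s1 _ _ [st1 ok1]; split; first exact: static_den.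
  exact: dist_step.
- split=> // u z; rewrite s8; case: eqP => [->|ne]; first by rewrite gdistxx subn0.
  split=> //; rewrite leqn0 => /eqP/(gdist_eq0 (@adj_connected R I)).
  by move=> uz; case: ne.
move=> u z; have [up lo] := ok u z; apply/eqP; rewrite eqn_leq up lo //.
by apply: ltnW; apply: gdist_lt_card; exact: adj_connected.
Qed.

(** * Simulation of greedy runs by the program *)

Variable W : R.
Hypothesis weight_leW : forall t, weight t <= W :> R.
Variable pi0 : {perm V}.
Hypothesis pi0P : forall t, pi0 (start t) = dest t.
Implicit Type pi : {perm V}.

Record sim s l pi : Prop := Sim {
  sim_static : static s;
  sim_prox : forall u z, prox s u z = n - d u z;
  sim_perm : forall u, nmem s 9 (number u) = number (pi u);
  sim_output : output s = encode_swaps l;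
  sim_run : greedy_run W pi0 l pi
}.

Lemma sim_count s l pi : sim s l pi -> nmem s 4 0 = size l.
Proof.
by move=> [_ _ _ /(congr1 size) + _]; rewrite !size_map size_iota.
Qed.

Lemma sim_cell s l pi (a x : nat) : a \notin [:: 0; 1; 4; 5; 6; 7; 8; 9] ->
  sim s l pi -> sim (set_cell s a 0 x) l pi.
Proof.
rewrite !inE !negb_or => /and5P[a0 a1 a4 a5 /and4P[a6 a7 a8 a9]] [st px pm out run].
split=> //.
- by apply: static_cell => //; rewrite !inE !negb_or a0 a1 a7.
- by move=> u z; rewrite prox_cell.
- by move=> u; rewrite set_cell_other 1?eq_sym.
- by rewrite -out /output !set_cell_other 1?eq_sym.
Qed.

Definition improving pi u v : bool :=
  [&& e u v, d v (pi u) < d u (pi u)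
    & (pi v == v) || (d u (pi v) < d v (pi v))].

Lemma enabledE s l pi u v : sim s l pi ->
    nmem s 12 0 = number u -> nmem s 13 0 = number v ->
  beval s enabled = improving pi u v.
Proof.
move=> [[s_0 s_1 s_7] px pm _ _] su sv.
rewrite /= su sv !s_7 s_1 !pm -!/(prox s _ _) !px -eqn_leq.
(* Truncated subtraction from [n] reverses strict comparisons only because distances stay below
   [n]. *)
have closer x y z : ~~ (n - d x z <= n - d y z) = (d x z < d y z).
  have dx := gdist_lt_card (@adj_connected R I) x z.
  have dy := gdist_lt_card (@adj_connected R I) y z.
  by move: dx dy; move: (d x z) (d y z) (#|_|) => a b m; lia.
rewrite negb_and negbK !closer (inj_eq (@number_inj V)) /improving.
by case: (e u v).
Qed.

Lemma swap_correct s l pi u v : sim s l pi ->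
    nmem s 12 0 = number u -> nmem s 13 0 = number v -> improving pi u v ->
  sim (den swap_cmd s) (rcons l (u, v)) (tperm u v * pi)%g.
Proof.
move=> sm su sv /and3P[euv du dv]; have sk := sim_count sm.
have [st px pm out run] := sm.
have s9 x : nmem (den swap_cmd s) 9 x
    = if x == number v then number (pi u)
      else if x == number u then number (pi v) else nmem s 9 x.
  by rewrite /= /set_cell /= /update /= su sv !pm.
split.
- exact: static_den.
- by move=> x z; rewrite /prox den_frame //; exact: px.
- move=> x; rewrite s9 permM !(inj_eq (@number_inj V)).
  have [->|xv] := eqVneq x v; first by rewrite tpermR.
  have [->|xu] := eqVneq x u; first by rewrite tpermL.
  by rewrite tpermD 1?eq_sym ?pm.
- rewrite /encode_swaps map_rcons -/(encode_swaps l) -out /output.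
  have -> : nmem (den swap_cmd s) 4 0 = (size l).+1.
    by rewrite /= /set_cell /= /update /= sk addn1.
  rewrite sk -[(size l).+1]addn1 iotaD map_cat cats1 add0n; congr rcons.
    apply/eq_in_map => i; rewrite mem_iota add0n => /andP[_ lti].
    by rewrite /= /set_cell /= /update /= sk (ltn_eqF lti).
  by rewrite /= /set_cell /= /update /= sk eqxx su sv.
- exact: greedy_run_swap.
Qed.

Lemma improving1 u v : improving 1%g u v = false.
Proof. by rewrite /improving perm1 gdistxx ltn0 andbF. Qed.

(** When the sweep reaches a pair that was improving at its start, either a swap has already
    happened, or the permutation is unchanged and this pair is swapped. *)
Lemma sweep_correct s l pi : sim s l pi ->
  exists l' pi', [/\ sim (den sweep_cmd s) l' pi', pi = 1%g -> pi' = 1%g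
    & forall u v, improving pi u v -> size l < size l'].
Proof.
move=> sm; pose Inv s' := exists l' pi', [/\ sim s' l' pi', size l <= size l',
  size l' = size l -> pi' = pi & pi = 1%g -> pi' = 1%g].
pose le s1 s2 := nmem s1 4 0 <= nmem s2 4 0.
pose Q u v s' := improving pi u v -> size l < nmem s' 4 0.
have le_trans s1 s2 s3 : le s1 s2 -> le s2 s3 -> le s1 s3 by exact: leq_trans.
have Inv_cell (a x : nat) s1 : a \notin [:: 0; 1; 4; 5; 6; 7; 8; 9] ->
    Inv s1 -> Inv (set_cell s1 a 0 x).
  move=> anin [l1 [pi1 [sm1 le1 eq1 one1]]]; exists l1, pi1; split=> //.
  exact: sim_cell.
have le_cell (a x : nat) s1 : a != 4 -> le s1 (set_cell s1 a 0 x).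
  by move=> a4; rewrite /le set_cell_other // eq_sym.
have Qle u v s1 s2 : le s1 s2 -> Q u v s1 -> Q u v s2.
  by move=> le12 q /q/leq_trans; apply.
have Inv_static s1 : Inv s1 -> nmem s1 0 0 = n.
  by move=> [l1 [pi1 [[[s_0 _ _] _ _ _ _] _ _ _]]].
have [] := @for_sweep R n 12 (CFor 13 (CIf enabled swap_cmd)) s Inv le
    (fun i s => forall u v, i = number u -> Q u v s).
- by [].
- by case: (sim_static sm).
- by move=> ?; exact: leqnn.
- exact: le_trans.
- by move=> x s1; exact: le_cell.
- by move=> x s1; exact: Inv_cell.
- by move=> i s1 s2 le12 q u v iu; exact: Qle le12 (q u v iu).
- move=> i s1 lti s1i inv1; have [u iu] := number_surj lti.
  have [] := @for_sweep R n 13 (CIf enabled swap_cmd) s1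
      (fun s => Inv s /\ nmem s 12 0 = number u) le
      (fun j s => forall v, j = number v -> Q u v s).
  + by [].
  + exact: Inv_static.
  + by move=> ?; exact: leqnn.
  + exact: le_trans.
  + by move=> x s2; exact: le_cell.
  + by move=> x s2 [inv s2u]; split; [exact: Inv_cell|rewrite set_cell_other].
  + by move=> j s2 s3 le23 q v jv; exact: Qle le23 (q v jv).
  + move=> j s2 ltj s2j [[l2 [pi2 [sm2 le2 eq2 one2]]] s2u].
    have [v jv] := number_surj ltj.
    have s2v : nmem s2 13 0 = number v by rewrite s2j.
    have cnt2 := sim_count sm2.
    have -> : den (CIf enabled swap_cmd) s2
      = if beval s2 enabled then den swap_cmd s2 else s2 by [].
    rewrite (enabledE sm2 s2u s2v); case: ifP => [imp|nimp].
      have sm3 := swap_correct sm2 s2u s2v imp; have cnt3 := sim_count sm3.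
      rewrite size_rcons in cnt3.
      split; last by move=> v' _ _; rewrite cnt3 ltnS.
        split; last by rewrite den_frame.
        exists (rcons l2 (u, v)), (tperm u v * pi2)%g.
        split=> //; rewrite ?size_rcons; first exact: leqW.
          by move=> eql; rewrite -eql ltnn in le2.
        by move=> /one2 pi21; rewrite pi21 improving1 in imp.
      by rewrite /le cnt3 cnt2.
    split; [by split=> //; exists l2, pi2 | exact: leqnn|].
    move=> v'; rewrite jv => /number_inj <- imp; rewrite cnt2.
    rewrite ltn_neqAle le2 andbT; apply/eqP => eql.
    by rewrite (eq2 (esym eql)) imp in nimp.
  + by split=> //; rewrite s1i.
  move=> [inv _] le2 q2; split=> // u' v'; rewrite iu => /number_inj<-.
  exact: q2 (number_lt v') v' erefl.
- by exists l, pi; split.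
move=> [l' [pi' [sm' le' eq' one']]] _ q; exists l', pi'; split=> // u v imp.
rewrite -(sim_count sm'); exact: (q _ (number_lt u) u v erefl imp).
Qed.

Hypothesis acyc : acyclic e.

Lemma improving_ex pi : pi != 1%g -> exists u v, improving pi u v.
Proof.
case/(greedy_progress (@adj_connected R I) acyc) => u [v [euv du dv]].
by exists u, v; apply/and3P.
Qed.

(** Each sweep adds a swap unless the identity is already reached, and the identity persists. *)
Lemma main_loop_correct s : sim s [::] pi0 ->
  exists l, sim (den (CFor 14 (CFor 15 sweep_cmd)) s) l 1%g.
Proof.
move=> sm0.
pose P r s := exists l pi, sim s l pi /\ (pi = 1%g \/ r <= size l).
have P_cell (a x : nat) r s1 : a \notin [:: 0; 1; 4; 5; 6; 7; 8; 9] ->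
    P r s1 -> P r (set_cell s1 a 0 x).
  by move=> anin [l [pi [sm h]]]; exists l, pi; split=> //; exact: sim_cell.
have P_size r s1 : P r s1 -> nmem s1 0 0 = n.
  by move=> [l [pi [[[s_0 _ _] _ _ _ _] _]]].
have round r s1 : P r s1 -> P r.+1 (den sweep_cmd s1).
  move=> [l [pi [sm h]]]; have [l' [pi' [sm' one' lt']]] := sweep_correct sm.
  exists l', pi'; split=> //; have [pi1|pi1] := eqVneq pi 1%g.
    by left; exact: one'.
  right; have [u [v imp]] := improving_ex pi1.
  case: h => [h|h]; first by rewrite h eqxx in pi1.
  exact: leq_ltn_trans h (lt' u v imp).
have [|||||l [pi [sm]]] := @for_rule R n 14 (CFor 15 sweep_cmd) s
    (fun i s => P (i * n) s).
- by [].
- by case: (sim_static sm0).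
- by move=> i x s1; exact: P_cell.
- move=> i s1 _ _ inv1; rewrite mulSnr.
  apply: (@for_rule R n 15 sweep_cmd s1 (fun j s => P (i * n + j) s)).
  + by [].
  + exact: P_size inv1.
  + by move=> j x s2; exact: P_cell.
  + by move=> j s2 _ _; rewrite addnS; exact: round.
  + by rewrite addn0.
- by exists [::], pi0; split=> //; right.
move=> h; exists l; suff -> : 1%g = pi by [].
apply/eqP; rewrite eq_sym; case: h => [->//|size_l]; apply: contraT => pi1.
have [u [v /and3P[euv du dv]]] := improving_ex pi1.
(* After [n * n] swaps a misplaced token would allow one more, beyond the bound on greedy runs. *)
have := greedy_run_size (greedy_run_swap weight_leW (sim_run sm) euv du dv).
by rewrite size_rcons leqNgt ltnS size_l.
Qed.

Lemma algorithm_correct :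
  exists l, [/\ output (den algorithm (input_store I)) = encode_swaps l,
    valid_solution l & cost l <= travel_weight e (home_weight (I := I)) W pi0]%R.
Proof.
have [st8 e8 p8 c8] := init_correct.
set s1 := den init_cmd _ in st8 e8 p8 c8.
have sm : sim (den dist_cmd s1) [::] pi0.
  split.
  - exact: static_den.
  - exact: dist_correct.
  - move=> u; rewrite den_frame //; have [g _ gK] := @start_bij R I.
    by rewrite -{1}(gK u) p8 -pi0P gK.
  - by rewrite /output !den_frame // c8.
  - exact: greedy_run_start.
have [l sml] := main_loop_correct sm; exists l.
have [valid_l cost_l] := greedy_run_end weight_leW (sim_run sml).
by split=> //; exact: sim_output sml.
Qed.

End Algorithm.

(* Running time and approximation guarantee combined *)
From mathcomp Require Import classical_sets.
Local Open Scope classical_set_scope.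

Theorem theorem1 :
  exists (A : program) (p : {poly nat}),
    forall (R : realType) (I : wts_instance R) (w W : R),
      is_tree (@adj R I) ->
      is_minimum (range (@weight R I)) w ->
      is_maximum (range (@weight R I)) W ->
      exists (k : nat) (final : store R) (s : seq (vertex I * vertex I)) (OPT : R),
        [/\ exec A (input_store I) k final,
            (k <= p.[#|vertex I|])%N,
            output final = encode_swaps s,
            valid_solution s
          & is_OPT I OPT /\ cost s <= (1 + W / w) * OPT].
Proof.
exists (compile algorithm), (time_bound algorithm).
move=> R I w W [_ acyc] [[t0 _ t0w] lbw] [_ ubW].
have w_le (t : token I) : w <= weight t by apply: lbw; exists t.
have le_W (t : token I) : weight t <= W by apply: ubW; exists t.
have w_gt0 : 0 < w by rewrite -t0w weight_gt0.
have [pi0 pi0P] := start_perm_ex I.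
have [s [out_s valid_s cost_s]] := algorithm_correct le_W pi0P acyc.
have [k exec_k k_le] := exec_den algorithm_wf (erefl (nmem (input_store I) 0 0)).
have [OPT optP] := is_OPT_ex w_gt0 w_le valid_s.
exists k, (den algorithm (input_store I)), s, OPT; split=> //; split=> //.
(* The cost is at most the weighted travel, which is at most [1 + W / w] times [travel_cost], a
   lower bound for [OPT]. *)
apply: le_trans cost_s (le_trans (travel_weight_le pi0P w_gt0 w_le le_W) _).
apply: ler_wpM2l.
  by rewrite addr_ge0 // divr_ge0 ?(ltW w_gt0) // (le_trans (ltW w_gt0)) // (le_trans (w_le t0)).
by case: optP => -[l valid_l <-] _; exact: valid_solution_cost_ge.
Qed.
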